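(* Let $X$ be a real Banach space, $Y$ a Banach space, $f_i\colon X\to\mathbb{R}$, $i\in I_0=\{0\}\cup I$, $I=\{1,\ldots,n\}$. Let a mapping $F\colon X\to Y$ be continuously Fr\'echet differentiable at a point $x^*\in X$. Suppose that there exist Fr\'echet upper coexhausters $\overline{E}_i(x^* )$ of the functions $f_i$ at $x^*$, $i\in I_0$. Suppose also that the operator $F'[x^*]$ is surjective, and $x^*$ is a point of local minimum in the problem $$f_0(x)\to\inf,\quad F(x)=0,\quad f_i(x)\le0,\quad i\in I.$$ Then for any $C_i\in\overline{e}_i(x^* )$, $i\in R(x^* )$, there exists $y^*\in Y^*$ such that $$(0,\,y^*\circ F'[x^*])\in\operatorname{co}\bigcup_{i\in R(x^* )}C_i,$$ where $\overline{e}_i(x^* )=\{C\in\overline{E}_i(x^* )\mid\max_{(a,p)\in C}a=0\}$.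
   Context: $R(x)=\{0\}\cup\{i\in I\mid f_i(x)=0\}$; $\operatorname{co}$ is the convex hull; $X^*$, $Y^*$ are the topological duals. A nonempty family $\overline{E}(x)$ of nonempty convex bounded subsets of $\mathbb{R}\times X^*$, each compact in the product of the standard topology of $\mathbb{R}$ and the weak${}^*$ topology of $X^*$, is a Fr\'echet upper coexhauster of $f\colon X\to\mathbb{R}$ at $x$ if $\inf_{C\in\overline{E}(x)}\max_{(a,p)\in C}a=0$ and for all $\Delta x$ in a neighbourhood of zero $$f(x+\Delta x)-f(x)=\inf_{C\in\overline{E}(x)}\max_{(a,p)\in C}(a+p(\Delta x))+o(\Delta x,x),$$ where $o(\Delta x,x)/\|\Delta x\|\to0$ as $\Delta x\to0$. *)

(* Defs.v *)
From HB Require Import structures.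
From mathcomp Require Import all_boot all_order all_algebra.
From mathcomp Require Import all_classical all_reals all_analysis.
From mathcomp Require Import ring.

Set Implicit Arguments.
Unset Strict Implicit.
Unset Printing Implicit Defensive.

Import Order.TTheory GRing.Theory Num.Theory.
Import numFieldNormedType.Exports.

Local Open Scope classical_set_scope.
Local Open Scope ring_scope.

Section Dual.
Context {R : realType} (X : normedModType R).

Definition dual_pred : {pred X -> R^o} :=
  fun p => `[< linear p /\ continuous p >].

Lemma dual_predP (p : X -> R^o) :
  reflect (linear p /\ continuous p) (p \in dual_pred).
Proof. exact: asboolP. Qed.

Lemma dual_submod_closed : submod_closed dual_pred.
Proof.
split.
  apply/dual_predP; split=> [k u v|x]; first by rewrite scaler0 addr0.
  exact: (@cst_continuous X R^o).
move=> k p q /dual_predP[lp cp] /dual_predP[lq cq].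
apply/dual_predP; split=> [l u v|x].
  rewrite !fctE lp lq /GRing.scale/=; ring.
apply: (@continuousD R R^o X); last exact: cq.
by apply: (@continuousM R X (cst k)); [exact: cst_continuous|exact: cp].
Qed.

HB.instance Definition _ :=
  GRing.isSubmodClosed.Build _ _ dual_pred dual_submod_closed.

Record dual := Dual { dual_fun : X -> R^o; _ : dual_fun \in dual_pred }.

HB.instance Definition _ := [isSub for dual_fun].
HB.instance Definition _ := [Choice of dual by <:].
HB.instance Definition _ := [SubChoice_isSubLmodule of dual by <:].

(* The topology carried by [dual] is the weak* one; the dual norm is
   available separately, as [opnorm]. *)
HB.instance Definition _ :=
  Topological.copy dual
    (initial_topology (dual_fun : dual -> {ptws X -> R^o})).

Definition dual_app (p : dual) : X -> R := dual_fun p.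

End Dual.

Coercion dual_app : dual >-> Funclass.

Arguments dual_pred {R X} _ : simpl never.
Arguments dual_fun {R X} _ _.

Section DualComp.
Context {R : realType} {X Y : normedModType R}.

Lemma dual_comp_subproof (L : {linear X -> Y}) (cL : continuous L)
  (y : dual Y) : ((y : Y -> R^o) \o L : X -> R^o) \in dual_pred.
Proof.
have /dual_predP[ly cy] := valP y.
apply/dual_predP; split=> [k u v|x]; first by rewrite /= linearP; exact: ly.
exact: (@continuous_comp _ _ R^o L y x (cL x) (cy _)).
Qed.

Definition dual_comp (L : {linear X -> Y}) (cL : continuous L) (y : dual Y) :
  dual X := Dual (dual_comp_subproof cL y).

End DualComp.

(* Only meaningful for bounded linear operators: elsewhere the supremum may
   have the default value 0. *)
Definition opnorm {R : realType} {X Y : normedModType R} (L : X -> Y) : R :=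
  sup [set `|L v| | v in [set v : X | `|v| <= 1]].

(* Differentiability is required in a whole neighbourhood of [x], so that the
   values of ['d F] near [x] are genuine derivatives. *)
Definition continuously_differentiable_at {R : realType}
    {X Y : normedModType R} (F : X -> Y) (x : X) : Prop :=
  (\forall z \near x, differentiable F z) /\
  opnorm (fun v => 'd F z v - 'd F x v) @[z --> x] --> (0 : R).

Lemma continuously_differentiable_at_diff_continuous {R : realType}
    {X Y : normedModType R} (F : X -> Y) (x : X) :
  continuously_differentiable_at F x -> continuous ('d F x).
Proof. by move=> [/nbhs_singleton dF _]; exact: diff_continuous. Qed.

Definition convex_hull {R : numDomainType} {V : lmodType R} (A : set V) :
    set V := smallest (@convex_set R V) A.

Section Coexhausters.
Context {R : realType} {X : normedModType R}.
Implicit Types (C : set (R^o * dual X)) (E : set (set (R^o * dual X))).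

Definition dual_bounded C : Prop :=
  exists M : R, forall c, C c -> `|c.1| <= M /\ opnorm (c.2 : X -> R^o) <= M.

(* [max_fst C] is the maximum of a and [max_aff C v] that of a + p(v) over
   (a, p) in C; they are attained when C is nonempty and compact, see
   [max_fst_attained] and [max_aff_attained]. *)
Definition max_fst C : R := sup [set c.1 | c in C].
Definition max_aff C (v : X) : R := sup [set c.1 + c.2 v | c in C].

(* The infima are taken in the extended reals, so that the equations below
   force them to be finite. *)
Definition frechet_upper_coexhauster (f : X -> R) (x : X) E : Prop :=
  [/\ E !=set0,
      forall C, E C ->
        [/\ C !=set0, @convex_set R (R^o * dual X)%type C,
            dual_bounded C & compact C],
      ereal_inf [set (max_fst C)%:E | C in E] = 0%E &
      exists2 o : X -> R,
        \forall v \near (0 : X),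
          (f (x + v) - f x)%:E =
            (ereal_inf [set (max_aff C v)%:E | C in E] + (o v)%:E)%E &
        o v / `|v| @[v --> (0 : X)^'] --> (0 : R)].

Definition null_elements E : set (set (R^o * dual X)) :=
  [set C | E C /\ max_fst C = 0].

Lemma dual_app_continuous (v : X) : continuous (fun p : dual X => p v : R^o).
Proof.
have cf : continuous (dual_fun : dual X -> {ptws X -> R^o}).
  exact: (@initial_continuous (dual X) {ptws X -> R^o}).
have cv : continuous (fun g : {ptws X -> R^o} => g v).
  exact: (@proj_continuous X (fun=> R^o) v).
move=> p; exact: (continuous_comp (cf p) (cv _)).
Qed.

Lemma compact_sup_attained C (h : R^o * dual X -> R^o) :
  C !=set0 -> compact C -> continuous h ->
  exists2 c, C c &
    (forall d, C d -> h d <= h c) /\ sup [set h d | d in C] = h c.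
Proof.
move=> C0 cC ch.
have [c /set_mem Cc hc] := compact_EVT_max C0 cC (continuous_subspaceT ch).
have ub d : C d -> h d <= h c by move=> Cd; apply: hc; exact: mem_set.
exists c => //; split=> //; apply/eqP; rewrite eq_le; apply/andP; split.
  by apply: ge_sup => [|_ [d Cd <-]]; [exists (h c), c|exact: ub].
apply: ub_le_sup; last by exists c.
by exists (h c) => _ [d Cd <-]; exact: ub.
Qed.

Lemma max_fst_attained C : C !=set0 -> compact C ->
  exists2 c, C c & (forall d, C d -> d.1 <= c.1) /\ max_fst C = c.1.
Proof.
by move=> C0 cC; apply: compact_sup_attained => // c; exact: cvg_fst.
Qed.

Lemma max_aff_attained C (v : X) : C !=set0 -> compact C ->
  exists2 c, C c &
    (forall d, C d -> d.1 + d.2 v <= c.1 + c.2 v) /\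
    max_aff C v = c.1 + c.2 v.
Proof.
move=> C0 cC; apply: (@compact_sup_attained C (fun c => c.1 + c.2 v)) => // c.
apply: (@continuousD R R^o); first exact: cvg_fst.
apply: (@continuous_comp _ _ R^o (@snd R^o (dual X)) (fun p => p v)).
  exact: cvg_snd.
exact: dual_app_continuous.
Qed.

End Coexhausters.

(* The problem f_0 -> inf subject to F = 0 and f_i <= 0 for i >= 1, where the
   objective is the member of index [ord0] of the family [f]. *)
Section Problem.
Context {R : realType} {X Y : normedModType R} {n : nat}.
Variables (f : 'I_n.+1 -> X -> R) (F : X -> Y).

Definition feasible : set X :=
  [set x | F x = 0 /\ forall i, i != ord0 -> f i x <= 0].

Definition local_minimum (x : X) : Prop :=
  feasible x /\ \forall z \near x, feasible z -> f ord0 x <= f ord0 z.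

Definition active (x : X) : set 'I_n.+1 :=
  [set i | i = ord0 \/ f i x = 0].

End Problem.

(* Main.v *)
Require Import Defs.
From HB Require Import structures.
From mathcomp Require Import all_boot all_order all_algebra.
From mathcomp Require Import all_classical all_reals all_analysis.
From mathcomp Require Import ring lra.
Import Order.TTheory GRing.Theory Num.Theory.
Import numFieldNormedType.Exports.
Local Open Scope classical_set_scope.
Local Open Scope ring_scope.

Set Implicit Arguments.
Unset Strict Implicit.
Unset Printing Implicit Defensive.

(* The iterated convex join K of the active C_i is a weakly* compact convex
   subset of their convex hull.  It suffices to find (0, p) in K with p
   vanishing on the kernel N of F'[xs], because by the open mapping theorem
   such a p is of the form ys \o F'[xs].  If there is none, compactness leaves
   finitely many v_j in N such that no (0, p) in K has all p(v_j) = 0, and the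
   point of K minimising a^2 + \sum_j p(v_j)^2 provides w in N with
   a + p(w) <= -d < 0 on every active C_i (recall that a <= 0 there).  By
   Lyusternik's theorem F vanishes at points xs + t w + o(t), where the
   coexhauster expansions make every active f_i smaller than f_i(xs) and keep
   the inactive ones negative, contradicting minimality. *)

(** * Geometric iteration and the open mapping theorem *)

(** The increments are dominated by a geometric series, so their series converges absolutely; [u] is
    its sequence of partial sums shifted by [u 0]. *)
Lemma geometric_steps_cvg (R : realType) (V : completeNormedModType R)
    (u : nat -> V) (a : R) :
  (forall k, `|u k.+1 - u k| <= a * 2^-1 ^+ k) -> cvgn u.
Proof.
move=> ua.
have a0 : 0 <= a.
  by have := le_trans (normr_ge0 _) (ua 0%N); rewrite expr0 mulr1.
have h : cvgn (series (fun k => u k.+1 - u k)).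
  apply: normed_cvg; apply: (@series_le_cvg _ _ (geometric a 2^-1)) => [k|k|k|].
  - exact: normr_ge0.
  - by apply: geometric_ge0 => //; rewrite invr_ge0.
  - exact: ua.
  - apply: is_cvg_geometric_series.
    by rewrite ger0_norm ?invr_ge0// invf_lt1// ltr1n.
have -> : u = (fun k => u 0%N + series (fun k => u k.+1 - u k) k).
  by apply/funext => k; rewrite /series /= telescope_sumr// addrC subrK.
apply: is_cvgD; [exact: is_cvg_cst|exact: h].
Qed.

(* [x'] is the Newton-like correction of [x]: it halves the residual [G] at a
   cost proportional to the residual, so the iterates converge geometrically
   and stay where [`|x - x0| + 2 * c * `|G x|] is at most its initial value. *)
Lemma zero_of_halving_steps (R : realType) (X : completeNormedModType R)
    (Y : normedModType R) (G : X -> Y) (x0 : X) (c : R) :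
  0 <= c ->
  (forall x, `|x - x0| <= 2 * c * `|G x0| -> {for x, continuous G}) ->
  (forall x, `|x - x0| + 2 * c * `|G x| <= 2 * c * `|G x0| ->
    exists2 x', `|x' - x| <= c * `|G x| & `|G x'| <= 2^-1 * `|G x|) ->
  exists2 x, G x = 0 & `|x - x0| <= 2 * c * `|G x0|.
Proof.
move=> c0 cG step.
(* The step is made total so that it can be iterated; outside the region it does nothing. *)
have /choice[next nextP] : forall x, exists x',
    `|x - x0| + 2 * c * `|G x| <= 2 * c * `|G x0| ->
    `|x' - x| <= c * `|G x| /\ `|G x'| <= 2^-1 * `|G x|.
  move=> x; have [xr|xr] := boolP (`|x - x0| + 2 * c * `|G x| <=
    2 * c * `|G x0|).
    by have [x' h1 h2] := step _ xr; exists x'.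
  by exists x.
pose u k := iter k next x0.
have ur k : `|u k - x0| + 2 * c * `|G (u k)| <= 2 * c * `|G x0|.
  elim: k => [|k IH]; first by rewrite /u /= subrr normr0 add0r.
  have [h1 h2] := nextP _ IH; rewrite /u iterS -/(u k).
  have h3 : 2 * c * `|G (next (u k))| <= 2 * c * (2^-1 * `|G (u k)|).
    by rewrite ler_wpM2l// mulr_ge0.
  have -> : next (u k) - x0 = (next (u k) - u k) + (u k - x0).
    by rewrite addrA subrK.
  have := ler_normD (next (u k) - u k) (u k - x0); lra.
have Gu k : `|G (u k)| <= `|G x0| * 2^-1 ^+ k.
  elim: k => [|k IH]; first by rewrite expr0 mulr1.
  have [_ h2] := nextP _ (ur k); apply: le_trans h2 _.
  by rewrite exprS mulrCA ler_wpM2l// invr_ge0.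
have cu : cvgn u.
  apply: (@geometric_steps_cvg _ _ _ (c * `|G x0|)) => k.
  have [h1 _] := nextP _ (ur k).
  by apply: le_trans h1 _; rewrite -mulrA ler_wpM2l.
have lr : `|limn u - x0| <= 2 * c * `|G x0|.
  have cn : `|u k - x0| @[k --> \oo] --> `|limn u - x0|.
    by apply: cvg_norm; apply: cvgB => //; exact: cvg_cst.
  apply: (cvgr_to_le cn); apply: nearW => k; apply: le_trans (ur k).
  by rewrite lerDl !mulr_ge0.
exists (limn u) => //.
have cGu : `|G (u k)| @[k --> \oo] --> `|G (limn u)|.
  by apply: cvg_norm; apply: continuous_cvg cu; exact: cG.
have cGu0 : `|G (u k)| @[k --> \oo] --> (0 : R).
  apply: (@squeeze_cvgr _ _ _ _ (cst 0) (geometric `|G x0| 2^-1)).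
  - by apply: nearW => k; rewrite normr_ge0 /=.
  - exact: cvg_cst.
  - by apply: cvg_geometric; rewrite ger0_norm ?invr_ge0// invf_lt1// ltr1n.
by apply/eqP; rewrite -normr_eq0; apply/eqP; exact: cvg_unique cGu cGu0.
Qed.

(* Baire's theorem gives a ball in the closure of the image of some ball. *)
Lemma surjective_approx_preimage (R : realType) (X : normedModType R)
    (Y : completeNormedModType R) (L : {linear X -> Y}) :
  (forall y, exists x, L x = y) ->
  exists2 c : R, 0 <= c & forall y, exists2 x,
    `|x| <= c * `|y| & `|y - L x| <= 2^-1 * `|y|.
Proof.
move=> surjL.
pose A (k : nat) := closure [set L x | x in [set x | `|x| <= k%:R]].
have [k Ak] : exists k, ~ dense (~` A k).
  apply/existsNP => dA.
  have /Baire : forall k, open (~` A k) /\ dense (~` A k).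
    by move=> k; split=> //; apply: closed_openC; exact: closed_closure.
  move=> /(_ setT) []; [by exists 0|exact: openT|].
  move=> y [_ /= yA]; have [x xy] := surjL y.
  apply: (yA (Num.truncn `|x|).+1 Logic.I); apply: subset_closure.
  by exists x => //=; apply/ltW/truncnS_gt.
have [U [[y0 Uy0] UA]] := denseNE Ak.
have /nbhs_ballP[r /= r0 rU] := open_nbhs_nbhs Uy0.
have rA : ball y0 r `<=` A k.
  move=> z /rU Uz; apply: contrapT => Az.
  by have : (U `&` ~` A k) z by []; rewrite UA.
(* Both [y0 + y] and [y0] lie in the ball, so each is approximated by images of vectors of norm at
   most [k]; the difference of these approximates [y], whence [2 * k]. *)
have key y : `|y| < r -> forall e, 0 < e ->
    exists2 x, `|x| <= 2 * k%:R & `|y - L x| < e.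
  move=> yr e e0.
  have cl z : A k z -> exists2 x, `|x| <= k%:R & `|z - L x| < e / 2.
    move=> /(_ (ball z (e / 2))) [].
      by apply: nbhsx_ballx; rewrite divr_gt0.
    by move=> _ [[x /= xk <-]]; rewrite -ball_normE /= => ?; exists x.
  have [x1 x1k h1] : exists2 x, `|x| <= k%:R & `|(y0 + y) - L x| < e / 2.
    apply: cl; apply: rA; rewrite -ball_normE /=.
    by rewrite opprD addrA subrr add0r normrN.
  have [x2 x2k h2] : exists2 x, `|x| <= k%:R & `|y0 - L x| < e / 2.
    by apply: cl; apply: rA; exact: ballxx.
  exists (x1 - x2).
    by apply: le_trans (ler_normB _ _) _; lra.
  rewrite linearB.
  have -> : y - (L x1 - L x2) = (y0 + y - L x1) - (y0 - L x2).
    rewrite !opprB (addrC y0) -[y + y0 - _]addrA -addrA; congr (_ + _).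
    by rewrite (addrC (y0 - _)) subrKA.
  by apply: le_lt_trans (ler_normB _ _) _; lra.
exists (2 * k%:R * (2 / r)) => [|y].
  by rewrite !mulr_ge0 ?invr_ge0 ?(ltW r0).
have [->|y0n] := eqVneq y 0.
  by exists 0; rewrite ?(linear0 L) ?subr0 !normr0 ?mulr0.
have ny : 0 < `|y| by rewrite normr_gt0.
(* Rescaling by [t] gives [y] the norm [r / 2 < r], so that [key] applies. *)
pose t := r / 2 / `|y|.
have t0 : 0 < t by rewrite !divr_gt0.
have [] := key (t *: y) _ (t * (2^-1 * `|y|)) _.
- rewrite normrZ gtr0_norm// /t divfK ?gt_eqF//; lra.
- by rewrite !mulr_gt0// invr_gt0.
move=> x xk hx; exists (t^-1 *: x).
  rewrite normrZ gtr0_norm ?invr_gt0// /t.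
  have -> : 2 * k%:R * (2 / r) * `|y| = (r / 2 / `|y|)^-1 * (2 * k%:R).
    by field; rewrite !gt_eqF.
  by rewrite ler_wpM2l// invr_ge0 ltW.
rewrite linearZ -(ler_pM2l t0) -[X in X * `|_|](gtr0_norm t0) -normrZ.
by rewrite scalerBr scalerA divff ?gt_eqF// scale1r ltW.
Qed.

(** An approximate preimage of the residual [y - L x] is exactly a halving step for
    [fun x => y - L x]; starting from 0, the iteration ends at an exact preimage. *)
Lemma open_mapping (R : realType) (X Y : completeNormedModType R)
    (L : {linear X -> Y}) :
  continuous L -> (forall y, exists x, L x = y) ->
  exists2 c : R, 0 <= c & forall y, exists2 x, L x = y & `|x| <= c * `|y|.
Proof.
move=> cL /surjective_approx_preimage[c c0 Lc].
exists (2 * c) => [|y]; first by rewrite mulr_ge0.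
have [] := @zero_of_halving_steps _ _ _ (fun x => y - L x) 0 c c0.
- by move=> x _; apply: cvgB; [exact: cvg_cst|exact: cL].
- move=> x _; have [h h1 h2] := Lc (y - L x).
  by exists (x + h); [rewrite addrAC subrr add0r|rewrite linearD opprD addrA].
move=> x Lx; rewrite (linear0 L) !subr0 => xc.
by exists x => //; apply/esym/eqP; rewrite -subr_eq0; apply/eqP.
Qed.

(** * Strict differentiability and Lyusternik's theorem *)

(* Mean value inequality, by taking the supremum of the times at which the
   estimate holds. *)
Lemma increment_le_of_near (R : realType) (Y : normedModType R) (g : R -> Y)
    (K : R) :
  (forall t : R, 0 <= t <= 1 ->
    \forall s \near t, `|g s - g t| <= K * `|s - t|) ->
  `|g 1 - g 0| <= K.
Proof.
move=> gK.
pose A := [set t : R | 0 <= t <= 1 /\ `|g t - g 0| <= K * t].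
have A0 : A 0 by split; rewrite ?lexx ?ler01// subrr normr0 mulr0.
have hA : has_sup A by split; [exists 0|exists 1 => t [/andP[]]].
have c01 : 0 <= sup A <= 1.
  apply/andP; split; first exact: (ub_le_sup hA.2).
  by apply: ge_sup; [exists 0|move=> t [/andP[]]].
have [d [d0 dK]] : exists d : R, 0 < d /\
    forall s : R, `|sup A - s| < d -> `|g s - g (sup A)| <= K * `|s - sup A|.
  by have /nbhs_ballP[d d0 dK] := gK _ c01; exists d; split=> // s; exact: dK.
have [t [t01 gt] ht] := sup_adherent d0 hA.
have tc : t <= sup A by apply: (ub_le_sup hA.2); split.
have htd : `|sup A - t| < d by rewrite ger0_norm ?subr_ge0// ltrBlDr -ltrBlDl.
have step s s' : s <= s' -> `|g s' - g s| <= K * (s' - s) ->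
    `|g s - g 0| <= K * s -> `|g s' - g 0| <= K * s'.
  move=> ss' h1 h2; have -> : g s' - g 0 = (g s' - g s) + (g s - g 0).
    by rewrite addrA subrK.
  apply: le_trans (ler_normD _ _) _; lra.
have gc : `|g (sup A) - g 0| <= K * sup A.
  apply: (step _ _ tc _ gt); rewrite distrC.
  rewrite -(@ger0_norm _ (sup A - t)) ?subr_ge0//.
  by rewrite [`|sup A - t|]distrC dK.
have [c1|c1] := eqVneq (sup A) 1; first by rewrite c1 mulr1 in gc.
have {}c1 : sup A < 1 by rewrite lt_neqAle c1; case/andP: c01.
(* If [sup A < 1], the estimate at [sup A] extends to [s], a point of [A] beyond its supremum. *)
pose s := Num.min 1 (sup A + d / 2).
have cs : sup A < s by rewrite lt_min c1 ltrDl divr_gt0.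
have sd : s <= sup A + d / 2 by rewrite ge_min lexx orbT.
have s1 : s <= 1 by rewrite ge_min lexx.
suff : A s by move=> /(ub_le_sup hA.2); rewrite leNgt cs.
split; first by rewrite s1 andbT; case/andP: c01; lra.
apply: (step _ _ (ltW cs) _ gc).
rewrite -(@gtr0_norm _ (s - sup A)) ?subr_gt0// dK//.
by rewrite distrC gtr0_norm ?subr_gt0//; lra.
Qed.

(** Continuity bounds the set under the supremum, so [opnorm L] is a genuine least upper bound; the
    rest is homogeneity. *)
Lemma norm_le_opnorm (R : realType) (X Y : normedModType R)
    (L : {linear X -> Y}) (v : X) :
  continuous L -> `|L v| <= opnorm L * `|v|.
Proof.
move=> cL.
have [M LM] : exists M : R, forall x, `|L x| <= M * `|x|.
  have /linear_bounded_continuous/linear_boundedP := cL.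
  by move=> /pinfty_ex_gt0[M _ LM]; exists M.
have [->|v0] := eqVneq v 0; first by rewrite linear0 !normr0 mulr0.
have nv : 0 < `|v| by rewrite normr_gt0.
rewrite -ler_pdivrMr//; apply: ub_le_sup.
  exists (Num.max 0 M) => _ [w /= w1 <-]; apply: le_trans (LM w) _.
  have [M0|M0] := leP 0 M; first by rewrite ler_piMr.
  by rewrite mulr_le0_ge0// ltW.
exists (`|v|^-1 *: v); first by rewrite /= normrZ normfV normr_id mulVf ?gt_eqF.
by rewrite linearZ normrZ normfV normr_id mulrC.
Qed.

Lemma differentiable_near_le (R : realType) (X Y : normedModType R)
    (F : X -> Y) (z : X) (e : R) :
  differentiable F z -> 0 < e ->
  \forall h \near (0 : X), `|F (z + h) - F z - 'd F z h| <= e * `|h|.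
Proof.
move=> dF e0; have /eqaddoP/(_ _ e0) := diff_locally dF.
apply: filterS => h /=.
by rewrite !fctE /= [h + z]addrC opprD addrA.
Qed.

Lemma strictly_differentiable (R : realType) (X Y : normedModType R)
    (F : X -> Y) (x : X) (e : R) :
  continuously_differentiable_at F x -> 0 < e ->
  exists2 d : R, 0 < d & forall u v, `|u - x| < d -> `|v - x| < d ->
    `|F u - F v - 'd F x (u - v)| <= e * `|u - v|.
Proof.
move=> dF e0; have cL := continuously_differentiable_at_diff_continuous dF.
have [dFz /cvgr0_norm_lt/(_ (e / 2))] := dF; rewrite divr_gt0// => /(_ isT) oF.
have : \forall z \near x, differentiable F z /\
    `|opnorm (fun v => 'd F z v - 'd F x v)| < e / 2.
  by near=> z; split; near: z.
move=> /nbhs_normP[d /= d0 Fd]; exists d => // u v ud vd.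
(* The mean value inequality is applied to [g]. Its local slope is at most [e * |u - v|]: one
   [e / 2] comes from the remainder of [F] at [z], the other from the distance between the
   derivatives at [z] and [x]. *)
pose g (t : R) := F (v + t *: (u - v)) - t *: 'd F x (u - v).
have -> : F u - F v - 'd F x (u - v) = g 1 - g 0.
  by rewrite /g !scale1r !scale0r addr0 subr0 [v + _]addrC subrK addrAC.
apply: increment_le_of_near => t /andP[t0 t1].
pose z := v + t *: (u - v).
have [dz oz] : differentiable F z /\
    `|opnorm (fun v => 'd F z v - 'd F x v)| < e / 2.
  apply: Fd => /=; rewrite distrC.
  have -> : z - x = t *: (u - x) + (1 - t) *: (v - x).
    rewrite scalerBl scale1r addrCA -scalerBr opprB addrA subrK.
    by rewrite /z addrAC.
  apply: le_lt_trans (ler_normD _ _) _.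
  rewrite !normrZ ger0_norm// ger0_norm ?subr_ge0//.
  have [->|t1'] := eqVneq t 1; first by rewrite subrr mul0r addr0 mul1r.
  have : 0 < 1 - t by rewrite subr_gt0 lt_neqAle t1'.
  nra.
have opz w : `|'d F z w - 'd F x w| <= e / 2 * `|w|.
  have := @norm_le_opnorm _ _ _ ('d F z \- 'd F x) w.
  have -> : (('d F z \- 'd F x : {linear X -> Y}) : X -> Y) =
    (fun v => 'd F z v - 'd F x v) by [].
  move=> /(_ _)/le_trans; apply.
    by move=> y; apply: cvgB; [exact: diff_continuous|exact: cL].
  by rewrite ler_wpM2r// (le_trans (ler_norm _))// ltW.
have e20 : 0 < e / 2 by rewrite divr_gt0.
have := differentiable_near_le dz e20.
move=> /nbhs_normP[r /= r0 Hr].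
have : \forall s \near t, `|(s - t) *: (u - v)| < r.
  (* The added 1 covers the case [u = v]. *)
  apply/nbhs_normP; exists (r / (`|u - v| + 1)).
    by rewrite /= divr_gt0 ?ltr_wpDl.
  move=> s /=; rewrite distrC ltr_pdivlMr ?ltr_wpDl// normrZ.
  move=> /(le_lt_trans _); apply.
  by rewrite ler_wpM2l// lerDl.
apply: filterS => s sr.
have := Hr ((s - t) *: (u - v)); rewrite /= sub0r normrN => /(_ sr) h1.
have h2 := opz ((s - t) *: (u - v)).
have -> : g s - g t =
  (F (z + (s - t) *: (u - v)) - F z - 'd F z ((s - t) *: (u - v))) +
  ('d F z ((s - t) *: (u - v)) - 'd F x ((s - t) *: (u - v))).
  have -> : z + (s - t) *: (u - v) = v + s *: (u - v).
    by rewrite /z -addrA -scalerDl [t + _]addrC subrK.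
  rewrite addrA subrK [X in _ = _ - X]linearZZ scalerBl !opprB addrACA.
  by rewrite [RHS]addrACA [_ - F z]addrC.
apply: le_trans (ler_normD _ _) _.
move: h1 h2; rewrite normrZ; lra.
Unshelve. all: by end_near. Qed.

(** Newton's iteration with the derivative frozen at [x]: the correction [h] solves
    ['d F x h = F z], and strict differentiability bounds the new residual by half of the old
    one. *)
Lemma zero_near_of_surjective_diff (R : realType)
    (X Y : completeNormedModType R) (F : X -> Y) (x : X) :
  continuously_differentiable_at F x -> (forall y, exists v, 'd F x v = y) ->
  exists2 c : R, 0 <= c & exists2 d : R, 0 < d &
    forall x0, `|x0 - x| + c * `|F x0| < d ->
      exists2 x1, F x1 = 0 & `|x1 - x0| <= c * `|F x0|.
Proof.
move=> dF surjL; have cL := continuously_differentiable_at_diff_continuous dF.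
have [c c0 Lc] := open_mapping cL surjL.
(* With this tolerance a step [h] of norm at most [c * |F z|] leaves a residual of at most
   [|F z| / 2]; [c + 1] replaces [c], which may be 0. *)
have e0 : 0 < (2 * (c + 1))^-1 by rewrite invr_gt0; lra.
have [d1 d10 Fd1] := strictly_differentiable dF e0.
have [/nbhs_normP[d2 /= d20 Fd2] _] := dF.
exists (2 * c); first lra.
exists (Num.min d1 d2) => [|x0]; first by rewrite lt_min d10.
rewrite lt_min => /andP[x0d1 x0d2].
apply: zero_of_halving_steps => // z.
  move=> zx0; apply: differentiable_continuous; apply: Fd2 => /=.
  by have := ler_distD x0 z x; rewrite [`|x - z|]distrC; lra.
move=> zx0; have [h Lh hc] := Lc (F z).
exists (z - h); first by rewrite addrAC subrr add0r normrN.
have z0 := normr_ge0 (F z).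
have zd1 : `|z - x| < d1 by have := ler_distD x0 z x; nra.
have zhd1 : `|z - h - x| < d1.
  rewrite addrAC; apply: le_lt_trans (ler_normB _ _) _.
  by have := ler_distD x0 z x; nra.
have := Fd1 _ _ zhd1 zd1; rewrite [z - h - z]addrAC subrr add0r linearN Lh.
rewrite opprK subrK normrN => /le_trans; apply.
rewrite mulrC ler_pdivrMr; last lra.
apply: le_trans hc _; lra.
Qed.

(** * Weak* dual and factorisation of functionals *)

Section Dual.
Context {R : realType} {X : normedModType R}.
Implicit Types (p q : dual X) (v : X) (k : R).

Lemma dualDE p q v : (p + q) v = p v + q v. Proof. by []. Qed.

Lemma dualZE k p v : (k *: p) v = k * p v. Proof. by []. Qed.

Lemma dual_is_linear p : linear (p : X -> R^o).
Proof. by have /dual_predP[] := valP p. Qed.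

Lemma dual_is_continuous p : continuous (p : X -> R^o).
Proof. by have /dual_predP[] := valP p. Qed.

Lemma dual_eqP p q : (forall v, p v = q v) -> p = q.
Proof. by move=> pq; apply/val_inj/funext => v; exact: pq. Qed.

(** Bundles [p] with its linearity, so that the general lemmas on linear maps apply to it. *)
Definition dual_linear p : {linear X -> R^o} :=
  HB.pack (p : X -> R^o)
    (GRing.isLinear.Build R X R^o *:%R (p : X -> R^o) (dual_is_linear p)).

Lemma dual_applyD p v w : p (v + w) = p v + p w.
Proof. exact: (linearD (dual_linear p)). Qed.

Lemma dual_applyN p v : p (- v) = - p v.
Proof. exact: (linearN (dual_linear p)). Qed.

Lemma dual_applyB p v w : p (v - w) = p v - p w.
Proof. exact: (linearB (dual_linear p)). Qed.

Lemma dual_applyZ p k v : p (k *: v) = k * p v.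
Proof. exact: (linearZ_LR (dual_linear p)). Qed.

Lemma dual_apply_sum p (I : Type) (s : seq I) (v : I -> X) :
  p (\sum_(i <- s) v i) = \sum_(i <- s) p (v i).
Proof. exact: (linear_sum (dual_linear p)). Qed.

Lemma dual_norm_le p v : `|p v| <= opnorm (p : X -> R^o) * `|v|.
Proof.
exact: (@norm_le_opnorm _ _ _ (dual_linear p) v (@dual_is_continuous p)).
Qed.

Lemma snd_apply_continuous v :
  continuous (fun c : R^o * dual X => c.2 v : R^o).
Proof.
move=> w; apply: (@continuous_comp _ _ R^o snd (fun p : dual X => p v)).
  exact: cvg_snd.
exact: dual_app_continuous.
Qed.

(** The weak* topology is the initial one for the evaluations, so continuity is tested at each
    vector. *)
Lemma continuous_to_dual (T : topologicalType) (g : T -> dual X) :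
  (forall v, continuous (fun t => g t v : R^o)) -> continuous g.
Proof.
move=> cg.
apply: (@continuous_comp_initial (dual X) T {ptws X -> R^o} (@dual_fun _ _)).
move=> t; apply/cvg_sup => v; move: t.
pose ev (h : {ptws X -> R^o}) := h v.
exact: (@continuous_comp_initial _ T R^o ev _ (cg v)).
Qed.

End Dual.

(** Since [p] is constant on the fibres of [L], the value [p (T y)] does not depend on the chosen
    right inverse [T]. Hence [p \o T] is linear although [T] may not be, and it is bounded because
    open mapping supplies preimages of controlled norm. *)
Lemma dual_comp_onto (R : realType) (X Y : completeNormedModType R)
    (L : {linear X -> Y}) (cL : continuous L) (p : dual X) :
  (forall y, exists v, L v = y) -> (forall v, L v = 0 -> p v = 0) ->
  exists q : dual Y, p = dual_comp cL q.
Proof.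
move=> surjL pL; have [c c0 Lc] := open_mapping cL surjL.
have /choice[T LT] := surjL.
have pT v w : L v = L w -> p v = p w.
  by move=> vw; apply/eqP; rewrite -subr_eq0 -dual_applyB pL// linearB vw subrr.
have lin : linear (p \o T : Y -> R^o).
  move=> k u v /=; rewrite -[k *: p _]dual_applyZ -dual_applyD; apply: pT.
  by rewrite linearP !LT.
pose q0 : {linear Y -> R^o} := HB.pack (p \o T : Y -> R^o)
  (GRing.isLinear.Build R Y R^o *:%R (p \o T : Y -> R^o) lin).
have cq : continuous (p \o T : Y -> R^o).
  apply: (@bounded_linear_continuous _ _ _ q0); apply/linear_boundedP.
  exists (`|opnorm (p : X -> R^o)| * c); split; first exact: num_real.
  move=> r rc y; have [v Lv vy] := Lc y.
  have -> : q0 y = p v by apply: pT; rewrite LT.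
  apply: le_trans (dual_norm_le p v) _.
  apply: le_trans (ler_wpM2r (normr_ge0 v) (ler_norm _)) _.
  apply: le_trans (ler_wpM2l (normr_ge0 _) vy) _.
  by rewrite mulrA ler_wpM2r// ltW.
have q_pred : (p \o T : Y -> R^o) \in dual_pred by apply/dual_predP.
by exists (Dual q_pred); apply: dual_eqP => v; apply: pT; rewrite LT.
Qed.

(** * Compact convex hulls of finite unions *)

Section ConvexJoin.
Context {R : realType} {V : lmodType R}.
Implicit Types A B : set V.

Lemma convex_setP A : @convex_set R V A <->
  forall x y a b, A x -> A y -> 0 <= a -> 0 <= b -> a + b = 1 ->
    A (a *: x + b *: y).
Proof.
split=> [cA x y a b Ax Ay a0 b0 ab1|cA x y t].
  have a1 : a <= 1 by rewrite -ab1 lerDl.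
  have -> : b = 1 - a by rewrite -ab1 addrAC subrr add0r.
  have a01 : Itv.spec (@Itv.num_sem R) (Itv.Real `[0%Z, 1%Z]) a.
    by rewrite /= /Itv.num_sem /= num_real in_itv/= a0 a1.
  by have /set_mem := cA x y (Itv.mk a01) (mem_set Ax) (mem_set Ay).
move=> /set_mem Ax /set_mem Ay; apply/mem_set.
by apply: cA => //; rewrite ?subr_ge0// addrC subrK.
Qed.

(** Stated without division, so that callers need not treat [a + b = 0] separately. *)
Lemma convex_cone_combination A x y a b :
  @convex_set R V A -> A x -> A y -> 0 <= a -> 0 <= b ->
  exists2 z, A z & (a + b) *: z = a *: x + b *: y.
Proof.
move=> /convex_setP cA Ax Ay a0 b0.
have [/eqP|ab0] := eqVneq (a + b) 0.
  rewrite paddr_eq0// => /andP[/eqP-> /eqP->].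
  by exists x; rewrite // addr0 !scale0r addr0.
exists ((a / (a + b)) *: x + (b / (a + b)) *: y).
  apply: cA => //; rewrite ?divr_ge0 ?addr_ge0//.
  by rewrite -mulrDl divff.
by rewrite scalerDr !scalerA ![(a + b) * _]mulrC !divfK.
Qed.

(** For nonempty convex [A] and [B] this is the convex hull of their union; it is empty as soon as
    one of them is. *)
Definition convex_join A B : set V :=
  [set z | exists x y (a : R), [/\ A x, B y, 0 <= a <= 1 &
    z = a *: x + (1 - a) *: y]].

Lemma convex_convex_join A B :
  @convex_set R V A -> @convex_set R V B -> @convex_set R V (convex_join A B).
Proof.
move=> cA cB; apply/convex_setP.
move=> ? ? s t [x [y [a [Ax By /andP[a0 a1] ->]]]].
move=> [x' [y' [a' [Ax' By' /andP[a'0 a'1] ->]]]] s0 t0 st1.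
have [x2 Ax2 x2E] : exists2 z, A z & (s * a + t * a') *: z =
    (s * a) *: x + (t * a') *: x'.
  by apply: convex_cone_combination => //; rewrite mulr_ge0.
have [y2 By2 y2E] : exists2 z, B z & (s * (1 - a) + t * (1 - a')) *: z =
    (s * (1 - a)) *: y + (t * (1 - a')) *: y'.
  by apply: convex_cone_combination => //; rewrite mulr_ge0// subr_ge0.
exists x2, y2, (s * a + t * a'); split => //; first by apply/andP; split; nra.
have -> : 1 - (s * a + t * a') = s * (1 - a) + t * (1 - a').
  by rewrite -[1 in LHS]st1; ring.
by rewrite x2E y2E !scalerDr !scalerA addrACA.
Qed.

End ConvexJoin.

(** The join is the continuous image [h] of the product of [[0, 1]], [A] and [B]; weak* continuity
    of [h] is checked vector by vector. *)
Lemma compact_convex_join (R : realType) (X : normedModType R)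
    (A B : set (R^o * dual X)) :
  compact A -> compact B -> compact (convex_join A B).
Proof.
move=> kA kB.
pose h (z : R^o * ((R^o * dual X) * (R^o * dual X))) : R^o * dual X :=
  (z.1 * z.2.1.1 + (1 - z.1) * z.2.2.1, z.1 *: z.2.1.2 + (1 - z.1) *: z.2.2.2).
have -> : convex_join A B = h @` (`[0, 1]%classic `*` (A `*` B)).
  apply/seteqP; split=> [_ [x [y [a [Ax By a01 ->]]]]|].
    by exists (a, (x, y)) => //; split => //=; rewrite in_itv.
  move=> _ [[a [x y]] [/= a01 [Ax By]] <-]; exists x, y, a; split => //.
apply: continuous_compact; last first.
  by apply: compact_setX; [exact: segment_compact|exact: compact_setX].
apply: continuous_subspaceT => z.
have c1 : continuous (fun z : R^o * ((R^o * dual X) * (R^o * dual X)) => z.1).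
  by move=> ?; exact: cvg_fst.
have cx : continuous (fun z : R^o * ((R^o * dual X) * (R^o * dual X)) => z.2.1).
  by move=> ?; apply: cvg_comp; [exact: cvg_snd|exact: cvg_fst].
have cy : continuous (fun z : R^o * ((R^o * dual X) * (R^o * dual X)) => z.2.2).
  by move=> ?; apply: cvg_comp; [exact: cvg_snd|exact: cvg_snd].
have comb (f g : R^o * dual X -> R^o) : continuous f -> continuous g ->
    continuous (fun z : R^o * ((R^o * dual X) * (R^o * dual X)) =>
      z.1 * f z.2.1 + (1 - z.1) * g z.2.2 : R^o).
  move=> cf cg w; apply: (@cvgD R R^o).
    apply: (@cvgM R); first exact: c1.
    exact: (continuous_comp (cx w) (cf _)).
  apply: (@cvgM R); last exact: (continuous_comp (cy w) (cg _)).
  by apply: (@cvgB R R^o); [exact: cvg_cst|exact: c1].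
apply: (@cvg_pair _ _ _ _ (nbhs (h z).1) (nbhs (h z).2)).
  by apply: (comb fst fst) => w; exact: cvg_fst.
apply: (@continuous_to_dual R X _ (fun w => (h w).2)) => v.
have c2 := @snd_apply_continuous _ _ v; exact: (comb _ _ c2 c2).
Qed.

(** [K] is the iterated join. Nonemptiness of the [C j] is what places each of them inside it. *)
Lemma compact_convex_cover (R : realType) (X : normedModType R) (I : eqType)
    (C : I -> set (R^o * dual X)) (i : I) (s : seq I) :
  (forall j, j \in i :: s ->
    [/\ C j !=set0, @convex_set R (R^o * dual X)%type (C j) & compact (C j)]) ->
  exists K : set (R^o * dual X), [/\ @convex_set R (R^o * dual X)%type K,
    compact K,
    forall j, j \in i :: s -> C j `<=` K &
    forall H : set (R^o * dual X), @convex_set R (R^o * dual X)%type H ->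
      (forall j, j \in i :: s -> C j `<=` H) -> K `<=` H].
Proof.
elim: s i => [i Ci|j s IH i Ci].
  have [_ ? ?] := Ci i (mem_head _ _).
  exists (C i); split => // [j|H _]; first by rewrite inE => /eqP->.
  by apply; exact: mem_head.
have [|K [cK kK CK KH]] := IH j.
  by move=> l ls; apply: Ci; rewrite inE ls orbT.
have [[x Cx] cCi kCi] := Ci i (mem_head _ _).
have [|[y Cy] _ _] := Ci j; first by rewrite !inE eqxx orbT.
exists (convex_join (C i) K); split.
- exact: convex_convex_join.
- exact: compact_convex_join.
- move=> l; rewrite inE => /orP[/eqP->|ls] z Cz.
    exists z, y, 1; split; rewrite ?ler01 ?lexx//.
      by apply: CK Cy; exact: mem_head.
    by rewrite subrr scale0r addr0 scale1r.
  exists x, z, 0; split; rewrite ?ler01 ?lexx//; first exact: CK Cz.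
  by rewrite subr0 scale0r add0r scale1r.
move=> H cH CH _ [u [w [a [Cu Kw /andP[a0 a1] ->]]]].
move/convex_setP : (cH); apply; rewrite ?subr_ge0//.
- by apply: CH Cu; exact: mem_head.
- by apply: KH Kw => // l ls; apply: CH; rewrite inE ls orbT.
- by rewrite addrC subrK.
Qed.

(** * Compactness and separation by a quadratic form *)

Section Separation.
Context {R : realType} {X : normedModType R}.
Implicit Types (K : set (R^o * dual X)) (W : set X).

(** Finite intersection property: the sets [Z s] generate a proper filter on [K], and a cluster
    point satisfies every condition because these are weak* closed. *)
Lemma compact_common_zero K W :
  compact K ->
  (forall s : seq X, (forall v, v \in s -> W v) ->
    exists c, [/\ K c, c.1 = 0 & forall v, v \in s -> c.2 v = 0]) ->
  exists c, [/\ K c, c.1 = 0 & forall v, W v -> c.2 v = 0].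
Proof.
move=> kK KW.
pose D : set (seq X) := [set s : seq X | forall v, v \in s -> W v].
pose Z (s : seq X) : set (R^o * dual X) :=
  [set c | [/\ K c, c.1 = 0 & forall v : X, v \in s -> c.2 v = 0]].
have FF : ProperFilter (filter_from D Z).
  apply: filter_from_proper; last by move=> s /KW.
  apply: filter_from_filter; first by exists [::].
  move=> s t Ds Dt; exists (s ++ t).
    by move=> v; rewrite mem_cat => /orP[/Ds|/Dt].
  move=> c [Kc c1 c2]; split; split=> // v vs; apply: c2.
    by rewrite mem_cat vs.
  by rewrite mem_cat vs orbT.
have [|c [Kc cc]] := kK _ FF; first by exists [::] => // c [].
have closedP (g : R^o * dual X -> R^o) s : continuous g -> D s ->
    (forall c, Z s c -> g c = 0) -> g c = 0.
  move=> cg Ds g0.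
  have clg : closed (g @^-1` [set 0]).
    by apply: closed_comp => [? _|]; [exact: cg|exact: closed_eq].
  apply: clg => U Uc; have [|c' [/g0 gc' Uc']] := cc (Z s) U _ Uc.
    by exists s.
  by exists c'.
exists c; split=> //.
  apply: (closedP fst [::]) => //; first by move=> ?; exact: cvg_fst.
  by move=> c' [].
move=> v Wv; apply: (closedP (fun c => c.2 v) [:: v]).
- exact: snd_apply_continuous.
- by move=> u; rewrite inE => /eqP->.
- by move=> c' [_ _]; apply; exact: mem_head.
Qed.

(** A positive semidefinite inner product whose null vectors are the [(0, p)] with [p] vanishing on
    [s]. *)
Let form (s : seq X) (c c' : R^o * dual X) : R :=
  c.1 * c'.1 + \sum_(v <- s) c.2 v * c'.2 v.

Let formC s c c' : form s c c' = form s c' c.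
Proof.
by rewrite /form mulrC; congr (_ + _); apply: eq_bigr => v _; rewrite mulrC.
Qed.

Let form_comb s c (x y : R^o * dual X) a b :
  form s c (a *: x + b *: y) = a * form s c x + b * form s c y.
Proof.
have e1 : (a *: x + b *: y).1 = a * x.1 + b * y.1 by [].
have e2 : (a *: x + b *: y).2 = a *: x.2 + b *: y.2 by [].
rewrite /form e1 e2 !mulrDr !mulr_sumr addrACA -big_split; congr (_ + _).
  by ring.
apply: eq_bigr => v _; rewrite dualDE !dualZE mulrDr.
by congr (_ + _); exact: mulrCA.
Qed.

Let form_ge0 s c : 0 <= form s c c.
Proof.
by rewrite /form addr_ge0 ?sumr_ge0// => [|v _]; rewrite -expr2 sqr_ge0.
Qed.

Let form_eq0 s c : form s c c = 0 -> c.1 = 0 /\ forall v, v \in s -> c.2 v = 0.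
Proof.
have h1 : 0 <= \sum_(v <- s) c.2 v * c.2 v.
  by rewrite sumr_ge0// => v _; rewrite -expr2 sqr_ge0.
have h0 : 0 <= (c.1 : R) * c.1 by rewrite -expr2 sqr_ge0.
move=> /eqP; rewrite /form paddr_eq0// mulf_eq0 orbb => /andP[/eqP c1].
rewrite psumr_eq0 => [/allP cs|v _]; last by rewrite -expr2 sqr_ge0.
split=> // v /cs /=; rewrite mulf_eq0 orbb => /eqP//.
Qed.

Let form_continuous s : continuous (fun c => - form s c c : R^o).
Proof.
move=> c; apply: (@cvgN R R^o); apply: (@cvgD R R^o).
  by apply: (@cvgM R); exact: cvg_fst.
apply: (@cvg_big R^o) => [z|v _].
  by apply: (@cvgD R R^o); [exact: cvg_fst|exact: cvg_snd].
by apply: (@cvgM R); exact: snd_apply_continuous.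
Qed.

(* The functional is the inner product with the point of [K] of least norm,
   for the quadratic form [a ^ 2 + \sum_v p v ^ 2]. *)
Lemma strictly_separated_from_zeros K (s : seq X) :
  K !=set0 -> compact K -> @convex_set R (R^o * dual X)%type K ->
  ~ (exists c, [/\ K c, c.1 = 0 & forall v, v \in s -> c.2 v = 0]) ->
  exists (a d : R) (q : dual X), 0 < d /\
    forall c, K c -> a * c.1 - c.2 (\sum_(v <- s) q v *: v) <= - d.
Proof.
move=> K0 kK /convex_setP cK Ks.
have [c0 Kc0 [c0max _]] := compact_sup_attained K0 kK (@form_continuous s).
have m0 : 0 < form s c0 c0.
  rewrite lt_neqAle form_ge0 andbT eq_sym; apply/eqP => /form_eq0[c1 c2].
  by apply: Ks; exists c0.
exists (- c0.1), (form s c0 c0), c0.2; split=> // c Kc.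
have -> : - c0.1 * c.1 - c.2 (\sum_(v <- s) c0.2 v *: v) = - form s c0 c.
  rewrite /form dual_apply_sum opprD mulNr; congr (_ - _).
  by apply: eq_bigr => v _; rewrite dual_applyZ.
rewrite lerN2 leNgt; apply/negP => lt0.
have Q0 := form_ge0 s c.
set m := form s c0 c0 in m0 lt0 *; set b := form s c0 c in lt0 *.
set Q := form s c c in Q0 *.
(* At [(1 - t) c0 + t c] the form equals [m - 2 t (m - b) + t^2 (m - 2 b + Q)], which for this [t]
   is at most [m - t (m - b) < m], against the minimality of [c0]. *)
have [t t0 [t1 tQ]] : exists2 t : R, 0 < t &
    t <= 1 /\ t * (m - 2 * b + Q) <= m - b.
  have [h|h] := leP (m - 2 * b + Q) (m - b).
    by exists 1; rewrite // mul1r.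
  have h0 : 0 < m - 2 * b + Q by lra.
  exists ((m - b) / (m - 2 * b + Q)); first by rewrite divr_gt0// subr_gt0.
  by split; [rewrite ler_pdivrMr// mul1r ltW|rewrite divfK// gt_eqF].
have /c0max : K ((1 - t) *: c0 + t *: c).
  by apply: cK; rewrite ?subr_ge0 ?subrK// ltW.
rewrite lerN2 leNgt => /negP; apply.
rewrite form_comb !(formC s (_ *: _ + _)) !form_comb.
rewrite (formC s c c0) -/m -/b -/Q.
nra.
Qed.

End Separation.

(** * Local estimates drawn from an upper coexhauster *)

Section Coexhauster.
Context {R : realType} {X : normedModType R}.
Context (f : X -> R) (x : X) (E : set (set (R^o * dual X)))
  (coexE : frechet_upper_coexhauster f x E).

(** The infimum over [E] is at most its term at [C], and the remainder is at most [e * |v|]. *)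
Lemma coexhauster_increment_le (C : set (R^o * dual X)) (e : R) :
  E C -> 0 < e ->
  \forall v \near (0 : X), f (x + v) - f x <= max_aff C v + e * `|v|.
Proof.
move=> EC e0; have [_ _ inf0 [g fg g0]] := coexE.
have max_aff0 D : max_aff D (0 : X) = max_fst D.
  rewrite /max_aff /max_fst; congr (sup _); apply/seteqP.
  split=> _ [c Dc <-]; exists c => //.
    by rewrite -(scale0r 0) dual_applyZ mul0r addr0.
  by rewrite -(scale0r 0) dual_applyZ mul0r addr0.
(* The limit of the remainder is taken over nonzero [v]; the value at 0 comes from the expansion,
   which there reads [0 = 0 + g 0]. *)
have g00 : g 0 = 0.
  have := nbhs_singleton fg; rewrite addr0 subrr.
  under eq_fun do rewrite max_aff0.
  by rewrite inf0 add0e => -[].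
have ge : \forall v \near (0 : X), g v <= e * `|v|.
  have /cvgr0_norm_lt/(_ _ e0) := g0; rewrite near_withinE.
  apply: filterS => v /= gv.
  have [->|v0] := eqVneq v 0; first by rewrite g00 normr0 mulr0.
  have nv : 0 < `|v| by rewrite normr_gt0.
  have := gv v0; rewrite normrM normfV normr_id ltr_pdivrMr// => /ltW.
  exact/le_trans/ler_norm.
near=> v.
rewrite -lee_fin (near fg v)//.
apply: (@le_trans _ _ ((max_aff C v)%:E + (g v)%:E)%E).
  by apply: leeD2r; apply: ereal_inf_lbound; exists C.
by rewrite -EFinD lee_fin lerD2l; near: v.
Unshelve. all: by end_near. Qed.

Lemma max_aff_le (C : set (R^o * dual X)) (v : X) (t : R) :
  C !=set0 -> (forall c, C c -> c.1 + c.2 v <= t) -> max_aff C v <= t.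
Proof.
move=> [c Cc] Ct; apply: ge_sup; first by exists (c.1 + c.2 v), c.
by move=> _ [c' /Ct ? <-].
Qed.

Lemma coexhauster_bound (C : set (R^o * dual X)) : E C ->
  exists2 M : R, 0 < M & forall c v, C c -> c.2 v <= M * `|v|.
Proof.
have [_ EP _ _] := coexE; move=> /EP[_ _ [M CM] _].
exists (`|M| + 1) => [|c v /CM[_ cM]]; first by rewrite ltr_wpDl.
apply: le_trans (ler_norm _) (le_trans (dual_norm_le _ _) _).
by rewrite ler_wpM2r// (le_trans cM)// (le_trans (ler_norm M))// lerDl.
Qed.

(* Since [c.1 <= 0] on [C], scaling [w] by [s <= 1] keeps the bound: it gives
   [c.1 + c.2 (s *: w) <= - s * d]. *)
Lemma coexhauster_descent (C : set (R^o * dual X)) (w : X) (d : R) :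
  E C -> 0 < d -> (forall c, C c -> c.1 <= 0 /\ c.1 + c.2 w <= - d) ->
  exists2 r0 : R, 0 < r0 & forall s r, 0 < s < r0 -> `|r| <= r0 * s ->
    f (x + (s *: w + r)) < f x.
Proof.
move=> EC d0 Cd; have [M M0 CM] := coexhauster_bound EC.
have [_ EP _ _] := coexE; have [C0 _ _ _] := EP C EC.
pose e := d / (4 * (`|w| + 1)).
have w1 : 0 < `|w| + 1 by rewrite ltr_wpDl.
have e0 : 0 < e by rewrite divr_gt0// mulr_gt0.
have /nbhs_norm0P[r1 /= r10 fr1] := coexhauster_increment_le EC e0.
(* The increment is at most [- s d + M |r| + e |s w + r|]; [r0] and [e] make each of the last two
   terms at most [s d / 4], and the bound by [r1] keeps [s w + r] where the expansion holds. *)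
pose r0 := Num.min 1 (Num.min (d / (4 * M)) (r1 / (`|w| + 1))).
have r00 : 0 < r0 by rewrite !lt_min ltr01 !divr_gt0// mulr_gt0.
have r0_1 : r0 <= 1 by rewrite /r0 ge_min lexx.
have r0_M : r0 * (4 * M) <= d.
  by rewrite -ler_pdivlMr ?mulr_gt0// /r0 !ge_min lexx orbT.
have r0_r1 : r0 * (`|w| + 1) <= r1.
  by rewrite -ler_pdivlMr// /r0 !ge_min lexx !orbT.
exists r0 => // s r /andP[s0 sr0] rs.
have swr : `|s *: w + r| <= s * (`|w| + 1).
  apply: le_trans (ler_normD _ _) _; rewrite normrZ gtr0_norm//.
  by have := normr_ge0 w; nra.
have /fr1 : `|s *: w + r| < r1.
  by apply: le_lt_trans swr (lt_le_trans _ r0_r1); rewrite ltr_pM2r.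
have aff : max_aff C (s *: w + r) <= - s * d + M * (r0 * s).
  apply: max_aff_le => // c Cc; have [c1 cw] := Cd c Cc.
  rewrite dual_applyD dual_applyZ.
  have := CM c r Cc; have : M * `|r| <= M * (r0 * s) by rewrite ler_wpM2l// ltW.
  have : s <= 1 by lra.
  nra.
have ew : e * `|s *: w + r| <= s * d / 4.
  apply: le_trans (ler_wpM2l (ltW e0) swr) _.
  by rewrite /e le_eqVlt; apply/orP; left; apply/eqP; field; rewrite gt_eqF.
have : s * (r0 * (4 * M)) <= s * d by rewrite ler_wpM2l// ltW.
have : 0 < s * d by rewrite mulr_gt0.
lra.
Qed.

(** As the infimum 0 may not be attained, some [C] with [max_fst C <= d / 2] is used, where
    [d = - f x]; near 0 the increment then stays below [d]. *)
Lemma coexhauster_usc (w : X) : f x < 0 ->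
  exists2 r0 : R, 0 < r0 & forall s r, 0 < s < r0 -> `|r| <= r0 * s ->
    f (x + (s *: w + r)) < 0.
Proof.
move=> fx; pose d := - f x; have d0 : 0 < d by rewrite oppr_gt0.
have [_ EP inf0 _] := coexE.
have [C EC Cd] : exists2 C, E C & max_fst C <= d / 2.
  have d20 : 0 < d / 2 by rewrite divr_gt0.
  have := @lb_ereal_inf_adherent R [set (max_fst C)%:E | C in E] _ d20.
  rewrite inf0 add0e.
  by move=> /(_ isT)[_ [C EC <-]]; rewrite lte_fin => /ltW; exists C.
have [M M0 CM] := coexhauster_bound EC; have [C0 _ _ kC] := EP C EC.
have /nbhs_norm0P[r1 /= r10 fr1] := coexhauster_increment_le EC ltr01.
have w1 : 0 < `|w| + 1 by rewrite ltr_wpDl.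
(* For [|v| < r2] the increment is at most [d / 2 + (M + 1) |v| < 3 d / 4]. *)
pose r2 := Num.min r1 (d / (4 * (M + 1))).
have r2_M : r2 * (4 * (M + 1)) <= d.
  by rewrite -ler_pdivlMr ?mulr_gt0 ?ltr_wpDl ?(ltW M0)// /r2 ge_min lexx orbT.
have r20 : 0 < r2 by rewrite lt_min r10 divr_gt0// mulr_gt0// ltr_wpDl// ltW.
have r2_r1 : r2 <= r1 by rewrite /r2 ge_min lexx.
pose r0 := Num.min 1 (r2 / (`|w| + 1)).
have r00 : 0 < r0 by rewrite lt_min ltr01 divr_gt0.
have r0_1 : r0 <= 1 by rewrite /r0 ge_min lexx.
have r0_r2 : r0 * (`|w| + 1) <= r2.
  by rewrite -ler_pdivlMr// /r0 ge_min lexx orbT.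
exists r0 => // s r /andP[s0 sr0] rs.
have vr2 : `|s *: w + r| < r2.
  apply: lt_le_trans r0_r2; apply: le_lt_trans (ler_normD _ _) _.
  rewrite normrZ gtr0_norm//.
  by have := normr_ge0 w; nra.
have := fr1 _ (lt_le_trans vr2 r2_r1).
set v := s *: w + r in vr2 *.
have aff : max_aff C v <= d / 2 + M * `|v|.
  apply: max_aff_le => // c Cc; apply: lerD; last exact: CM.
  have [c' _ [c'max c'E]] := max_fst_attained C0 kC.
  by apply: le_trans Cd; rewrite c'E; exact: c'max.
have : `|v| * (4 * (M + 1)) < d.
  by apply: lt_le_trans r2_M; rewrite ltr_pM2r// mulr_gt0// ltr_wpDl// ltW.
rewrite /d in aff *; lra.
Qed.

End Coexhauster.

(** * The multiplier rule by contradiction with local minimality *)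

Lemma convex_convex_hull (R : numDomainType) (V : lmodType R) (A : set V) :
  @convex_set R V (convex_hull A).
Proof.
move=> u v t /set_mem uA /set_mem vA; apply/mem_set => B BA.
by apply/set_mem/(proj1 BA); apply/mem_set; [exact: uA|exact: vA].
Qed.

Lemma common_radius (R : realType) (n : nat) (P : 'I_n -> R -> Prop) :
  (forall i a b, a <= b -> P i b -> P i a) ->
  (forall i, exists2 r, 0 < r & P i r) -> exists2 r, 0 < r & forall i, P i r.
Proof.
move=> Pmono Pr.
have /choice[r rP] : forall i, exists r, 0 < r /\ P i r.
  by move=> i; have [r] := Pr i; exists r.
exists (\big[Num.min/1]_i r i) => [|i].
  by apply: lt_bigmin => // i _; have [] := rP i.
by apply: Pmono (proj2 (rP i)); exact: bigmin_le_cond.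
Qed.

Theorem proposition5p13 (R : realType) (X Y : completeNormedModType R) (n : nat)
    (f : 'I_n.+1 -> X -> R) (F : X -> Y) (xs : X)
    (E : 'I_n.+1 -> set (set (R^o * dual X)))
    (dF : continuously_differentiable_at F xs)
    (coexE : forall i, frechet_upper_coexhauster (f i) xs (E i))
    (surjF : forall y : Y, exists v : X, 'd F xs v = y)
    (minxs : local_minimum f F xs)
    (C : 'I_n.+1 -> set (R^o * dual X))
    (nullC : forall i, active f xs i -> null_elements (E i) (C i)) :
  exists ys : dual Y,
    convex_hull (\bigcup_(i in active f xs) C i)
      (0, dual_comp (continuously_differentiable_at_diff_continuous dF) ys).
Proof.
set cL := continuously_differentiable_at_diff_continuous dF.
have act0 : active f xs ord0 by left.
(* [ord0] is prefixed below to obtain a visibly nonempty list; its repetition is harmless. *)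
pose s := [seq i <- enum 'I_n.+1 | `[< active f xs i >]].
have sP i : (i \in ord0 :: s) <-> active f xs i.
  rewrite inE mem_filter mem_enum andbT; split=> [/orP[/eqP->//|/asboolP//]|ai].
  by apply/orP; right; apply/asboolP.
have Cprop i : active f xs i ->
    [/\ C i !=set0, @convex_set R (R^o * dual X)%type (C i) & compact (C i)].
  move=> ai; have [ECi _] := nullC i ai; have [_ EP _ _] := coexE i.
  by have [] := EP _ ECi.
have [K [cK kK CK KH]] := @compact_convex_cover _ _ _ C ord0 s
  (fun i si => Cprop i (proj1 (sP i) si)).
have KC : K `<=` convex_hull (\bigcup_(i in active f xs) C i).
  apply: KH => [|i /sP ai z Cz].
    exact: convex_convex_hull.
  by apply: sub_gen_smallest; exists i.
suff [[a p] [Kc /= a0 pker]] :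
    exists c, [/\ K c, c.1 = 0 & forall v, 'd F xs v = 0 -> c.2 v = 0].
  have [ys pE] := dual_comp_onto cL surjF pker.
  by exists ys; rewrite -pE -a0; exact: KC.
apply: (@compact_common_zero _ _ _ [set v | 'd F xs v = 0]) => // l lker.
apply: contrapT => Kl.
have K0 : K !=set0.
  by have [[c Cc] _ _] := Cprop _ act0; exists c; apply: CK Cc; exact: mem_head.
have [a [d [q [d0 Kd]]]] := strictly_separated_from_zeros K0 kK cK Kl.
(* The sign of [a] is unknown; as [c.1 <= 0] and [a <= b], replacing [a] by the positive [b]
   preserves the separation, and dividing by [b] normalises it. *)
pose b := Num.max 1 a.
have b0 : 0 < b by rewrite lt_max ltr01.
have ab : a <= b by rewrite le_max lexx orbT.
pose w := - (b^-1 *: \sum_(v <- l) q v *: v).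
have Lw : 'd F xs w = 0.
  rewrite /w linearN linearZZ linear_sum big1_seq ?scaler0 ?oppr0// => v.
  move=> /andP[_ vl].
  by rewrite linearZZ (lker _ vl)// scaler0.
have db0 : 0 < d / b by rewrite divr_gt0.
have Cw i c : active f xs i -> C i c -> c.1 <= 0 /\ c.1 + c.2 w <= - (d / b).
  move=> ai Cc; have [C0 _ kC] := Cprop i ai; have [_ maxC] := nullC i ai.
  have c1 : c.1 <= 0.
    have [c' _ [c'max c'E]] := max_fst_attained C0 kC.
    by rewrite -maxC c'E c'max.
  split=> //; have /Kd : K c by apply: CK Cc; exact/sP.
  rewrite /w dual_applyN dual_applyZ; set z := c.2 _ => h.
  rewrite -(ler_pM2l b0) mulrDr !mulrN mulrA divff ?gt_eqF// mul1r.
  rewrite mulrCA divff ?gt_eqF// mulr1.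
  nra.
(* One monotone statement covers active and inactive indices, so a single radius can serve all of
   them. *)
pose P i (r0 : R) := forall (t : R) (r : X), 0 < t < r0 -> `|r| <= r0 * t ->
  active f xs i /\ f i (xs + (t *: w + r)) < f i xs \/
  ~ active f xs i /\ (f i xs < 0 -> f i (xs + (t *: w + r)) < 0).
have [r0 r00 descent] : exists2 r0 : R, 0 < r0 & forall i, P i r0.
  apply: common_radius => [i u v uv Pv t r /andP[t0 tu] rt|i].
    apply: Pv; first by rewrite t0 (lt_le_trans tu).
    by rewrite (le_trans rt)// ler_wpM2r// ltW.
  have [ai|nai] := pselect (active f xs i).
    have [EC _] := nullC i ai.
    have [|r r0 rP] := coexhauster_descent (w := w) (coexE i) EC db0.
      by move=> c; exact: Cw.
    by exists r => // *; left; split=> //; exact: rP.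
  have [fi|fi] := ltP (f i xs) 0.
    have [r r0 rP] := coexhauster_usc (coexE i) w fi.
    by exists r => // *; right; split=> // _; exact: rP.
  by exists 1 => // *; right; split=> //; rewrite ltNge fi.
have [[Fxs fxs] /nbhs_normP[r1 /= r10 min1]] := minxs.
have [k k0 [r2 r20 zeroF]] := zero_near_of_surjective_diff dF surjF.
(* As [w] is in the kernel, [|F (xs + t w)| <= e t |w|]; this [e] makes the Lyusternik correction at
   most [r0 * t]. *)
have [e e0 eE] : exists2 e : R, 0 < e & e * ((k + 1) * (`|w| + 1)) = r0.
  have kw : 0 < (k + 1) * (`|w| + 1) by rewrite mulr_gt0// ltr_wpDl.
  by exists (r0 / ((k + 1) * (`|w| + 1))); rewrite ?divr_gt0// divfK// gt_eqF.
have /nbhs_norm0P[r3 /= r30 Fr3] :=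
  differentiable_near_le (nbhs_singleton (proj1 dF)) e0.
have W0 : 0 < `|w| + r0 + 1 by rewrite ltr_wpDl// addr_ge0// ltW.
(* [t] must suit, in order, the descent estimates, local minimality, Lyusternik's theorem and the
   expansion of [F]. *)
have [t t0 [t_r0 t_r1 t_r2 t_r3]] : exists2 t : R, 0 < t &
    [/\ t * (`|w| + r0 + 1) < r0, t * (`|w| + r0 + 1) < r1,
        t * (`|w| + r0 + 1) < r2 & t * (`|w| + r0 + 1) < r3].
  pose m := Num.min r0 (Num.min r1 (Num.min r2 r3)).
  have m0 : 0 < m by rewrite !lt_min r00 r10 r20.
  exists (m / 2 / (`|w| + r0 + 1)); first by rewrite !divr_gt0.
  have : m / 2 < m by lra.
  by rewrite divfK ?gt_eqF// !lt_min => /and4P[].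
have w0 := normr_ge0 w.
have tw : `|t *: w| = t * `|w| by rewrite normrZ gtr0_norm.
have kF : k * `|F (xs + t *: w)| <= r0 * t.
  have := Fr3 (t *: w); rewrite /= tw Fxs linearZZ Lw scaler0 !subr0.
  have -> : t * `|w| < r3 by apply: le_lt_trans t_r3; rewrite ler_pM2l//; lra.
  move=> /(_ isT) Ftw.
  apply: le_trans (ler_wpM2l k0 Ftw) _.
  have : 0 <= (e * t) * (k + `|w| + 1).
    by apply: mulr_ge0; [apply: mulr_ge0; exact: ltW|lra].
  rewrite -eE; lra.
have [x1 Fx1 x1r] : exists2 x1, F x1 = 0 & `|x1 - (xs + t *: w)| <= r0 * t.
  have [|x1 Fx1 x1r] := zeroF (xs + t *: w).
    rewrite addrAC subrr add0r tw; apply: le_lt_trans t_r2; lra.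
  by exists x1 => //; apply: le_trans x1r kF.
pose r := x1 - (xs + t *: w).
have x1E : xs + (t *: w + r) = x1 by rewrite /r addrA [xs + _ + _]addrC subrK.
have t01 : 0 < t < r0 by rewrite t0 /=; nra.
have desc i := descent i t r t01 x1r; rewrite x1E in desc.
have x1feas : feasible f F x1.
  split=> // i i0; have [[[i00|fi0]]|[nai h]] := desc i.
  - by rewrite i00 eqxx in i0.
  - by rewrite fi0 => /ltW.
  - apply/ltW/h; rewrite lt_neqAle fxs// andbT; apply/eqP => fi0.
    by apply: nai; right.
have : f ord0 xs <= f ord0 x1.
  apply: min1 => //=.
  rewrite -x1E opprD addrA subrr add0r normrN; apply: le_lt_trans t_r1.
  apply: le_trans (ler_normD _ _) _; rewrite tw.
  have : `|r| <= r0 * t by [].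
  lra.
by have [[_ /lt_geF->]|[]] := desc ord0.
Qed.
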